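(* Let $s\in(0,1)$, let $A$ be an $N$-function on $[0,\infty)$ satisfying the $\Delta_2$ condition, and let $$\alpha_{s,A}(\lambda):=\sup_{t>0}\frac{A(\lambda t)}{\lambda^{1/s}A(t)}.$$ Assume that $\liminf_{\lambda\to0+}\lambda^{\frac{1-N}{s}}\alpha_{s,A}(\lambda)=0$ or $\liminf_{\lambda\to\infty}\lambda^{\frac{1-N}{s}}\alpha_{s,A}(\lambda)=0$. Then the fractional Orlicz Hardy inequality $FOHI(s,A)$ holds in $\mathbb{R}^N\setminus\{0\}$, that is, $H_{N,s,A}(\mathbb{R}^N\setminus\{0\})>0$.
   Context: An $N$-function is a continuous convex function $A:[0,\infty)\to[0,\infty)$ with $\lim_{t\to0}A(t)/t=0$ and $\lim_{t\to\infty}A(t)/t=\infty$. $A$ satisfies the $\Delta_2$ condition ($A\in\Delta_2$) if there is a constant $p>0$ with $A(2t)\le pA(t)$ for all $t>0$ (this forces $A(t)>0$ for $t>0$). For an open set $D\subsetneq\mathbb{R}^N$, $\delta_x=\delta_D(x):=\inf\{|x-y|:y\in D^c\}$ (so $\delta_x=|x|$ when $D=\mathbb{R}^N\setminus\{0\}$), $$M_{W^{s,A}(D)}(f):=\iint_{D\times D}A\left(\frac{|f(x)-f(y)|}{|x-y|^s}\right)\frac{dx\,dy}{|x-y|^N},\qquad H_{N,s,A}(D):=\inf_{f\in C_c^\infty(D),\,f\ne0}\frac{M_{W^{s,A}(D)}(f)}{\int_D A\left(|f(x)|/\delta_x^s\right)dx}.$$ $FOHI(s,A)$ holds in $D$ if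 $H_{N,s,A}(D)>0$. *)

(* Defs.v *)
From HB Require Import structures.
From mathcomp Require Import all_boot all_order all_algebra.
From mathcomp Require Import all_classical all_reals all_analysis.

Set Implicit Arguments.
Unset Strict Implicit.
Unset Printing Implicit Defensive.
Import Order.TTheory GRing.Theory Num.Theory.
Import numFieldNormedType.Exports.
Local Open Scope classical_set_scope.
Local Open Scope ring_scope.

(* R^n is 'rV[R]_n with the sigma-algebra generated by the coordinate maps,
   i.e. the Borel sigma-algebra. *)
Section measurable_rV.
Context (R : realType) (n : nat).

Let coord (i : 'I_n) (x : 'rV[R]_n) : measurableTypeR R := x ord0 i.

Let rV_set0 : g_sigma_preimage coord set0.
Proof. exact: sigma_algebra0. Qed.

Let rV_setC A : g_sigma_preimage coord A -> g_sigma_preimage coord (~` A).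
Proof. exact: sigma_algebraC. Qed.

Let rV_bigcup (F : _^nat) : (forall i, g_sigma_preimage coord (F i)) ->
  g_sigma_preimage coord (\bigcup_i (F i)).
Proof. exact: sigma_algebra_bigcup. Qed.

HB.instance Definition _ := @isMeasurable.Build
  (measure_tuple_display (R.-ocitv.-measurable).-sigma)
  'rV[R]_n (g_sigma_preimage coord) rV_set0 rV_setC rV_bigcup.

End measurable_rV.

Section measurable_fun_rV.
Context (R : realType) (n : nat).

Lemma measurable_coord_rV (i : 'I_n) :
  measurable_fun [set: 'rV[R]_n]
    (fun x : 'rV[R]_n => x ord0 i : measurableTypeR R).
Proof.
move=> _ Y mY; rewrite setTI; apply: sub_sigma_algebra => /=.
rewrite -bigcup_seq/=; exists i => /=; first by rewrite mem_index_enum.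
by exists Y => //; rewrite setTI.
Qed.

Lemma measurable_fun_rVP d (T : measurableType d) (f : T -> 'rV[R]_n) :
  (forall i, measurable_fun setT (fun x => f x ord0 i : measurableTypeR R)) ->
  measurable_fun setT f.
Proof.
move=> mf.
suff : @measurable _ 'rV[R]_n `<=` [set A | measurable (f @^-1` A)].
  by move=> H _ A mA; rewrite setTI; exact: H.
apply: smallest_sub.
  split=> /=; first by rewrite preimage_set0.
    by move=> A mA; rewrite setTD preimage_setC; exact: measurableC.
  by move=> F mF; rewrite preimage_bigcup; exact: bigcup_measurable.
rewrite -bigcup_seq => A [i _ [B mB <-]] /=.
rewrite setTI -[X in measurable X]setTI.
exact: (mf i measurableT B mB).
Qed.

End measurable_fun_rV.

Section lebesgue_measure_rV.
Context (R : realType).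

Definition cons_rV n (p : measurableTypeR R * 'rV[R]_n) : 'rV[R]_n.+1 :=
  \row_i (if unlift ord0 i is Some j then p.2 ord0 j else p.1).

Definition uncons_rV n (x : 'rV[R]_n.+1) : measurableTypeR R * 'rV[R]_n :=
  (x ord0 ord0, \row_j x ord0 (lift ord0 j)).

Lemma cons_rV0 n p : @cons_rV n p ord0 ord0 = p.1.
Proof. by rewrite mxE unlift_none. Qed.

Lemma cons_rVS n p i : @cons_rV n p ord0 (lift ord0 i) = p.2 ord0 i.
Proof. by rewrite mxE liftK. Qed.

Lemma cons_rVK n : cancel (@cons_rV n) (@uncons_rV n).
Proof.
move=> p; rewrite /uncons_rV cons_rV0 [RHS]surjective_pairing; congr pair.
by apply/rowP => j; rewrite mxE cons_rVS.
Qed.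

Lemma measurable_cons_rV n : measurable_fun setT (@cons_rV n).
Proof.
apply: measurable_fun_rVP => i.
have [j ->|->] := unliftP ord0 i.
  under eq_fun do rewrite cons_rVS.
  exact: (measurableT_comp (@measurable_coord_rV R n j) measurable_snd).
by under eq_fun do rewrite cons_rV0; exact: measurable_fst.
Qed.

Lemma measurable_uncons_rV n : measurable_fun setT (@uncons_rV n).
Proof.
apply/measurable_fun_pairP; split; first exact: measurable_coord_rV.
apply: measurable_fun_rVP => i /=.
by under eq_fun do rewrite mxE; exact: measurable_coord_rV.
Qed.

Section step.
Context (n : nat) (mu : {sigma_finite_measure set 'rV[R]_n -> \bar R}).

Definition lebesgue_rV_step : set 'rV[R]_n.+1 -> \bar R :=
  pushforward (lebesgue_measure \x mu)%E (@cons_rV n).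

Let prod := [the {measure set _ -> \bar R} of (lebesgue_measure \x mu)%E].

Let push : {measure set 'rV[R]_n.+1 -> \bar R} :=
  measure_function_pushforward__canonical__measure_function_Measure
    prod (@measurable_cons_rV n).

Let step0 : lebesgue_rV_step set0 = 0%E.
Proof. exact: (measure0 push). Qed.

Let step_ge0 A : (0 <= lebesgue_rV_step A)%E.
Proof. exact: (measure_ge0 push). Qed.

Let step_sigma_additive : semi_sigma_additive lebesgue_rV_step.
Proof. exact: (@measure_semi_sigma_additive _ _ _ push). Qed.

HB.instance Definition _ := isMeasure.Build _ _ _ lebesgue_rV_step
  step0 step_ge0 step_sigma_additive.

Let step_sigma_finite : sigma_finite setT lebesgue_rV_step.
Proof.
have /sigma_finiteP[F [TF ndF Foo]] := sigma_finiteT (@lebesgue_measure R).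
have /sigma_finiteP[G [TG ndG Goo]] := sigma_finiteT mu.
exists (fun i => @uncons_rV n @^-1` (F i `*` G i)).
  rewrite -preimage_bigcup (_ : \bigcup_i _ = setT) ?preimage_setT//.
  apply/seteqP; split=> // -[x y] _.
  have [i _ Fx] : (\bigcup_i F i) x by rewrite -TF.
  have [j _ Gy] : (\bigcup_i G i) y by rewrite -TG.
  exists (maxn i j) => //; split=> /=.
    by move: x Fx; exact/subsetPset/ndF/leq_maxl.
  by move: y Gy; exact/subsetPset/ndG/leq_maxr.
move=> i; have [? ?] := Foo i; have [? ?] := Goo i; split.
  rewrite -[X in measurable X]setTI; apply: measurable_uncons_rV => //.
  exact: measurableX.
rewrite /lebesgue_rV_step /pushforward -comp_preimage.
rewrite (_ : _ \o _ = id); last by apply/funext => p /=; rewrite cons_rVK.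
by rewrite preimage_id product_measure1E// lte_mul_pinfty// ge0_fin_numE.
Qed.

HB.instance Definition _ := Measure_isSigmaFinite.Build _ _ _ lebesgue_rV_step
  step_sigma_finite.

End step.

(* On R^0, a point, it is the Dirac mass; on R^(n+1) it is the image of the
   product measure under the identification of R x R^n with R^(n+1). *)
Fixpoint lebesgue_rV n : {sigma_finite_measure set 'rV[R]_n -> \bar R} :=
  if n is m.+1 then lebesgue_rV_step (lebesgue_rV m) else dirac (0 : 'rV[R]_0).

Lemma lebesgue_rV_box n (A : 'I_n -> set (measurableTypeR R)) :
  (forall i, measurable (A i)) ->
  lebesgue_rV n [set x | forall i, A i (x ord0 i)] =
  (\prod_(i < n) lebesgue_measure (A i))%E.
Proof.
elim: n A => [A _|n ih A mA].
  rewrite big_ord0 (_ : mkset _ = setT) /= ?diracT//.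
  by apply/seteqP; split => // x _ [].
rewrite big_ord_recl -(ih (fun i => A (lift ord0 i)))// -product_measure1E//.
  rewrite /= /lebesgue_rV_step /pushforward; congr (_ _).
  apply/seteqP; split => p /=.
    move=> Ap; split=> /=; first by have := Ap ord0; rewrite cons_rV0.
    by move=> i; have := Ap (lift ord0 i); rewrite cons_rVS.
  move=> [A0 AS] i; have [j ->|->] := unliftP ord0 i; last by rewrite cons_rV0.
  by rewrite cons_rVS; exact: AS.
rewrite [X in measurable X](_ : _ =
    \bigcap_(i in [set: 'I_n]) ((fun x : 'rV[R]_n => x ord0 i) @^-1` A (lift ord0 i))).
  apply: fin_bigcap_measurable => // i _.
  by rewrite -[X in measurable X]setTI; exact: measurable_coord_rV.
by apply/seteqP; split => [x Ax i _|x Ax i]; [exact: Ax|exact: Ax i I].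
Qed.

End lebesgue_measure_rV.

Section orlicz_hardy.
Context (R : realType).

(* An N-function is defined on [0, +oo[: the values of A on negative arguments
   are irrelevant. *)
Definition N_function (A : R -> R) :=
  [/\ forall t, 0 <= t -> 0 <= A t,
      {within `[0, +oo[, continuous A},
      convex_function (`[0, +oo[%classic : set R) A,
      A t / t @[t --> 0^'+] --> 0 &
      A t / t @[t --> +oo] --> +oo].

Definition Delta2 (A : R -> R) :=
  exists2 p, 0 < p & forall t, 0 < t -> A (2 * t) <= p * A t.

Definition alpha (s : R) (A : R -> R) (lambda : R) : \bar R :=
  ereal_sup [set (A (lambda * t) / (lambda `^ s^-1 * A t))%:E
            | t in [set t | 0 < t]].

Context (N : nat).
Implicit Types (s : R) (A : R -> R) (D : set 'rV[R]_N) (f : 'rV[R]_N -> R).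

(* The library norm on 'rV[R]_N is the sup norm; the Euclidean norm induces the
   same topology. *)
Definition enorm (x : 'rV[R]_N) : R := Num.sqrt (\sum_i x ord0 i ^+ 2).

Definition dist_compl D (x : 'rV[R]_N) : R := inf [set enorm (x - y) | y in ~` D].

Definition partials (l : seq 'I_N) f : 'rV[R]_N -> R :=
  foldr (fun i g x => 'D_(delta_mx ord0 i : 'rV[R]_N) (g : _ -> R^o) x) f l.

Definition smooth f := forall l : seq 'I_N,
  continuous (partials l f) /\
  forall i x, derivable (partials l f : _ -> R^o) x (delta_mx ord0 i).

(* C_c^oo(D), its elements being extended by 0 outside D. *)
Definition test_function D f :=
  [/\ smooth f, compact (closure [set x | f x != 0]) &
      closure [set x | f x != 0] `<=` D].

Definition sobolev_modular s A D f : \bar R :=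
  (\int[lebesgue_rV R N \x lebesgue_rV R N]_(z in D `*` D)
    (A (`|f z.1 - f z.2| / enorm (z.1 - z.2) `^ s)
       / enorm (z.1 - z.2) ^+ N)%:E)%E.

Definition hardy_modular s A D f : \bar R :=
  (\int[lebesgue_rV R N]_(x in D) (A (`|f x| / dist_compl D x `^ s))%:E)%E.

(* In \bar R, x / 0 is +oo for x > 0 and 0 / 0 is 0. *)
Definition hardy_constant s A D : \bar R :=
  ereal_inf [set (sobolev_modular s A D f / hardy_modular s A D f)%E
            | f in [set f | test_function D f /\ f <> cst 0]].

Definition FOHI s A D := (0 < hardy_constant s A D)%E.

End orlicz_hardy.

(* Main.v *)
Require Import Defs.
From mathcomp Require Import all_boot all_order all_algebra.
From mathcomp Require Import all_classical all_reals all_analysis.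
From mathcomp Require Import measurable_realfun.
From mathcomp Require Import lra ring.
Import Order.TTheory GRing.Theory Num.Theory.
Import numFieldNormedType.Exports.
Local Open Scope classical_set_scope.
Local Open Scope ring_scope.
Set Implicit Arguments.
Unset Strict Implicit.
Unset Printing Implicit Defensive.

(** Write |x| for the Euclidean norm, g(x) = A(|f x| / |x|^s) and
    rho = lambda^(1/s). The proof compares f at x with f at the points y of
    norm comparable to rho |x|. The y taken are those in a sup-norm ball B_x of
    radius rho |x| / 2, whose volume is exactly (rho |x|)^N.

    By Delta_2 and convexity, A(u + v) <= K (A(u) + A(v)), so for y in B_x

      g(x) <= K A(|f x - f y| / |x|^s) + K A(|f y| / |x|^s).

    As |x - y| is at most a multiple of |x|, the first term, divided by
    (rho |x|)^N, is at most C1 times the Sobolev density at (x, y). In the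
    second, |x| is at least |y| / (2 N rho), so the argument of A is at most
    (2 N)^s lambda |f y| / |y|^s; by definition of alpha and by Delta_2 again
    the term is at most a constant times alpha(lambda) rho g(y). Hence
    ([transport_pointwise])

      g(x) / (rho |x|)^N
        <= C1 Phi(x, y) + C alpha(lambda) rho g(y) / |y|^N.

    Integrate over the pairs with y in B_x, by Tonelli. The left side gives the
    Hardy modular H, because the volume of B_x cancels the denominator. For
    given y the admissible x lie in a ball of volume (4 |y| / rho)^N, so the
    last term gives a multiple of alpha(lambda) rho^(1 - N) H
    ([hardy_modular_transport]). The factor
    alpha(lambda) rho^(1 - N) = lambda^((1 - N)/s) alpha(lambda) is the one in
    the hypothesis. Under either alternative some lambda makes the coefficient
    of H at most 1/2; as H is finite for a test function, that term is absorbed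
    in the left side, and H <= 2 C1 M, where M is the Sobolev modular and C1
    does not depend on f.

    The quotient M / H is then bounded below by 1 / (2 C1) provided that H is
    neither infinite nor zero ([hardy_modular_fin], [hardy_modular_gt0]), which
    holds because f vanishes near the origin and off a bounded set, and A is
    positive on positive arguments. *)

(** * N-functions and the Delta_2 condition *)

Section N_function_theory.
Context {R : realType} {A : R -> R}.
Hypothesis NA : N_function A.

Lemma N_function_ge0 t : 0 <= t -> 0 <= A t.
Proof. by case: NA => + _ _ _ _; exact. Qed.

(** Near 0, A(t) = (A(t)/t) t is a product of two quantities tending to 0, and
    A is continuous at 0. *)
Lemma N_function_at0 : A 0 = 0.
Proof.
case: NA => _ cA _ A0 _.
have /continuous_within_itvcyP[_ cA0] := cA.
apply: (cvg_unique _ cA0) => //=.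
have : (A t / t) * t @[t --> 0^'+] --> (0 * 0 : R).
  by apply: cvgM => //; apply: cvg_within.
rewrite mulr0; apply: cvg_trans; apply: near_eq_cvg.
by near=> t; rewrite /= mulfVK// gt_eqF.
Unshelve. all: by end_near. Qed.

Lemma N_function_convex t x y : 0 <= t <= 1 -> 0 <= x -> 0 <= y ->
  A (t * x + (1 - t) * y) <= t * A x + (1 - t) * A y.
Proof.
move=> /andP[t0 t1] x0 y0; case: NA => _ _ cA _ _.
by have := cA (Itv01 t0 t1) x y; rewrite !inE/= !in_itv/= !andbT; exact.
Qed.

(** Convexity and A(0) = 0 give A(x) <= (x/y) A(y) for x <= y. *)
Lemma N_function_nd x y : 0 <= x <= y -> A x <= A y.
Proof.
move=> /andP[x0 xy]; have [y0|y0] := leP y 0.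
  by have -> : x = y by apply/eqP; rewrite eq_le xy (le_trans y0).
have xy1 : x / y <= 1 by rewrite ler_pdivrMr ?mul1r.
have xy0 : 0 <= x / y by rewrite divr_ge0 ?(ltW y0).
have := @N_function_convex (x / y) y 0 _ (ltW y0) (lexx _).
rewrite mulr0 addr0 N_function_at0 mulr0 addr0 mulrVK ?unitfE ?gt_eqF//.
rewrite xy0 xy1 => /(_ erefl) /le_trans; apply.
by rewrite ler_piMl// N_function_ge0 ?ltW.
Qed.

(** A is arbitrary on negative arguments, so measurability is obtained from the
    function t |-> A(max(0, t)), which is nondecreasing on the whole line. *)
Lemma N_function_measurable d (T : measurableType d) (g : T -> R) :
  (forall x, 0 <= g x) -> measurable_fun setT g ->
  measurable_fun setT (A \o g).
Proof.
move=> g0 mg; rewrite (_ : _ \o _ = (A \o Num.max 0) \o g); last first.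
  by apply/funext => x /=; rewrite max_r.
apply: measurableT_comp => //; apply: nondecreasing_measurable => //.
move=> x y xy /=; apply: N_function_nd.
by rewrite le_max lexx/= ge_max le_max lexx/= le_max xy orbT.
Qed.

Hypothesis D2A : Delta2 A.

(** Iterate the doubling inequality until 2^n exceeds c. *)
Lemma Delta2_scale c : 0 < c ->
  exists2 K, 0 < K & forall t, 0 <= t -> A (c * t) <= K * A t.
Proof.
have [p p0 Ap] := D2A.
have {}Ap t : 0 <= t -> A (2 * t) <= p * A t.
  rewrite le_eqVlt => /predU1P[<-|/Ap//].
  by rewrite mulr0 N_function_at0 mulr0.
have A2n n t : 0 <= t -> A (2 ^+ n * t) <= p ^+ n * A t.
  move=> t0; elim: n => [|n ih]; first by rewrite !expr0 !mul1r.
  rewrite !exprS -!mulrA (le_trans (Ap _ _))//.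
    by rewrite mulr_ge0 ?exprn_ge0.
  by rewrite ler_pM2l.
move=> c0; pose n := Num.truncn c.
exists (p ^+ n.+1) => [|t t0]; first exact: exprn_gt0.
apply: le_trans (A2n _ _ t0); apply: N_function_nd.
rewrite (mulr_ge0 (ltW c0) t0)/=; apply: ler_wpM2r => //.
apply: (le_trans (ltW (truncnS_gt c))).
by rewrite -natrX ler_nat ltnW// ltn_expl.
Qed.

(** A is positive far out, by superlinear growth; Delta_2 bounds those values by
    a multiple of A(t). *)
Lemma Delta2_gt0 t : 0 < t -> 0 < A t.
Proof.
move=> t0; case: NA => _ _ _ _ /cvgryPgt/(_ 0).
move=> [M [_ MA]].
pose x := Num.max (M + 1) t.
have x0 : 0 < x by rewrite lt_max t0 orbT.
have Ax : 0 < A x.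
  have := MA x; rewrite lt_max ltrDl ltr01/= => /(_ isT).
  by rewrite pmulr_lgt0 ?invr_gt0.
have [K K0 /(_ t (ltW t0))] := Delta2_scale (divr_gt0 x0 t0).
rewrite mulfVK ?gt_eqF// => /(lt_le_trans Ax).
by rewrite pmulr_rgt0.
Qed.

(** u + v is twice the midpoint of u and v: Delta_2 removes the factor 2 and
    convexity splits the midpoint. *)
Lemma Delta2_add : exists2 K, 0 < K & forall u v, 0 <= u -> 0 <= v ->
  A (u + v) <= K * (A u + A v).
Proof.
have [K K0 AK] := Delta2_scale (ltr0Sn _ 1); exists K => // u v u0 v0.
have -> : u + v = 2 * (2^-1 * u + (1 - 2^-1) * v) by field.
have h : 2^-1 * A u + (1 - 2^-1) * A v <= A u + A v.
  by have := N_function_ge0 u0; have := N_function_ge0 v0; lra.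
rewrite (le_trans (AK _ _))// ?ler_pM2l//; first by lra.
by apply: le_trans h; apply: N_function_convex => //; lra.
Qed.

End N_function_theory.

(** * Euclidean norm, balls and Borel sets of row vectors *)

Section row_vectors.
Context {R : realType} {N : nat}.
Implicit Types (x y : 'rV[R]_N) (t : R).

Lemma enorm_ge0 x : 0 <= enorm x.
Proof. exact: sqrtr_ge0. Qed.

Lemma coord_le_enorm x i : `|x ord0 i| <= enorm x.
Proof.
rewrite -sqrtr_sqr ler_wsqrtr// (bigD1 i)//= lerDl.
by apply: sumr_ge0 => j _; exact: sqr_ge0.
Qed.

(** A crude bound, sqrt N <= N being enough where only comparability of norms
    matters; it also replaces the triangle inequality for [enorm]. *)
Lemma enorm_le x t : 0 <= t -> (forall i, `|x ord0 i| <= t) ->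
  enorm x <= N%:R * t.
Proof.
move=> t0 xt; rewrite -[leRHS]ger0_norm ?mulr_ge0// -sqrtr_sqr ler_wsqrtr//.
apply: (@le_trans _ _ (\sum_(i < N) t ^+ 2)).
  by apply: ler_sum => i _; rewrite -real_normK ?num_real// lerXn2r// nnegrE.
rewrite sumr_const card_ord -[leLHS]mulr_natl exprMn ler_wpM2r ?sqr_ge0//.
by rewrite -natrX ler_nat; case: (N) => // n; rewrite leq_pmulr.
Qed.

Lemma enorm_gt0 x : x != 0 -> 0 < enorm x.
Proof.
apply: contra_neqT; rewrite -leNgt => x0; apply/rowP => i; rewrite mxE.
by apply/normr0_eq0/le_anti; rewrite normr_ge0 (le_trans (coord_le_enorm _ _)).
Qed.

Lemma dist_compl_origin x : dist_compl (~` [set 0]) x = enorm x.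
Proof.
rewrite /dist_compl setCK (_ : image _ _ = [set enorm x]) ?inf1//.
by apply/seteqP; split=> [_ [_ -> <-]|_ ->]; [|exists 0 => //]; rewrite subr0.
Qed.

(** Balls of row vectors are open cubes, which is why their Lebesgue measure is
    available exactly. *)
Lemma rV_ballE x t y : 0 < t ->
  ball x t y <-> forall i, `|x ord0 i - y ord0 i| < t.
Proof.
move=> t0; split=> [[_ xy] i|xy]; first exact: (xy ord0 i).
by split=> // i j; rewrite ord1; exact: xy.
Qed.

Lemma measurable_rV_ball x t : 0 < t -> measurable (ball x t : set 'rV[R]_N).
Proof.
move=> t0; rewrite (_ : ball x t = \bigcap_(i in [set: 'I_N])
    (fun y : 'rV[R]_N => y ord0 i) @^-1` ball (x ord0 i) t); last first.
  apply/seteqP; split=> y.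
    by move=> /(rV_ballE _ _ t0) xy i _; exact: xy.
  by move=> xy; apply/(rV_ballE _ _ t0) => i; exact: (xy i I).
apply: fin_bigcap_measurable => // i _; rewrite -[X in measurable X]setTI.
by apply: measurable_coord_rV => //; exact: measurable_ball.
Qed.

(** The sigma-algebra is generated by the coordinates, not by the topology: an
    open set is a countable union of balls with rational centres and radii
    1/(n+1). *)
Lemma open_measurable_rV (U : set 'rV[R]_N) : open U -> measurable U.
Proof.
move=> oU; pose c (q : 'rV[rat]_N) : 'rV[R]_N := map_mx ratr q.
pose B (p : 'rV[rat]_N * nat) : set 'rV[R]_N :=
  if `[< ball (c p.1) p.2.+1%:R^-1 `<=` U >] then ball (c p.1) p.2.+1%:R^-1
  else set0.
rewrite (_ : U = \bigcup_p B p).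
  apply: countable_bigcupT_measurable => // p; rewrite /B.
  by case: ifPn => // _; apply: measurable_rV_ball; rewrite invr_gt0.
apply/seteqP; split=> [x Ux|x [p _]]; last first.
  by rewrite /B; case: ifPn => // /asboolP; exact.
have /nbhs_ballP[e /= e0 eU] : nbhs x U by exact: open_nbhs_nbhs.
have [n ne] : exists n, n.+1%:R^-1 < e / 2.
  exists (Num.truncn (e / 2)^-1); rewrite invf_plt ?posrE ?divr_gt0//.
  exact: truncnS_gt.
have n0 : 0 < n.+1%:R^-1 :> R by rewrite invr_gt0.
have /choice[q qx] : forall i, exists q : rat,
    `|ratr q - x ord0 i| < n.+1%:R^-1.
  move=> i.
  have /rat_in_itvoo[q] : x ord0 i < x ord0 i + n.+1%:R^-1 by rewrite ltrDl.
  rewrite in_itv/= => /andP[xq qx]; exists q.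
  by rewrite ger0_norm ?subr_ge0 ?ltW// ltrBlDl.
pose r := \row_i q i; have cx : ball (c r) n.+1%:R^-1 x.
  by apply/(rV_ballE _ _ n0) => i; rewrite !mxE.
exists (r, n) => //; rewrite /B /= ifT//; apply/asboolP => y cy.
apply: eU; rewrite (splitr e); apply: (@ball_triangle _ _ (c r)).
  by apply: ball_sym; apply: le_ball cx; exact: ltW.
by apply: le_ball cy; exact: ltW.
Qed.

Lemma continuous_measurable_rV (f : 'rV[R]_N -> R) :
  continuous f -> measurable_fun setT f.
Proof.
move=> cf; apply: (measurability (@RGenOInfty.G R)) => [|_ [_ [a ->] <-]].
  exact: RGenOInfty.measurableE.
rewrite setTI; apply: open_measurable_rV.
by apply: open_comp => [x _|]; [exact: cf|rewrite set_itvoy; exact: open_gt].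
Qed.

Lemma measurable_enorm d (T : measurableType d) (g : T -> 'rV[R]_N) :
  measurable_fun setT g -> measurable_fun setT (fun z => enorm (g z)).
Proof.
move=> mg.
have msqrt : measurable_fun [set: R] (@Num.sqrt R).
  by apply: nondecreasing_measurable => // x y; exact: ler_wsqrtr.
apply: (measurableT_comp msqrt); apply: measurable_sum => i.
apply: measurable_funX.
exact: (measurableT_comp (@measurable_coord_rV R N i)).
Qed.

Lemma measurable_subrV d (T : measurableType d) (g h : T -> 'rV[R]_N) :
  measurable_fun setT g -> measurable_fun setT h ->
  measurable_fun setT (fun z => g z - h z).
Proof.
move=> mg mh; apply: measurable_fun_rVP => i.
under eq_fun do rewrite !mxE.
by apply: measurable_funB;
  exact: (measurableT_comp (@measurable_coord_rV R N i)).
Qed.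

Lemma lebesgue_rV_ball x t : 0 < t ->
  lebesgue_rV R N (ball x t) = ((2 * t) ^+ N)%:E.
Proof.
move=> t0.
have -> : ball x t =
    [set y | forall i, `]x ord0 i - t, x ord0 i + t[%classic (y ord0 i)].
  apply/seteqP; split => y /=; first move=> /(rV_ballE _ _ t0) xy i.
    by have := xy i; rewrite /= in_itv/= -ltr_distlC.
  move=> xy; apply/(rV_ballE _ _ t0) => i.
  by have := xy i; rewrite /= in_itv/= -ltr_distlC.
rewrite (@lebesgue_rV_box _ _
  (fun i => `]x ord0 i - t, x ord0 i + t[%classic)); last first.
  by move=> i; exact: measurable_itv.
under eq_bigr.
  move=> i _; rewrite lebesgue_measure_itv/= lte_fin ltrBlDr -addrA ltrDl.
  rewrite addr_gt0// -EFinB (_ : _ - _ = 2 * t); last by ring.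
  over.
by rewrite prodEFin prodr_const card_ord.
Qed.

End row_vectors.

(** * Integrals over pairs lying in a moving ball *)

Section moving_ball.
Context {R : realType} {N : nat}.
Hypothesis N0 : (0 < N)%N.
Local Notation T := 'rV[R]_N.
Local Notation mu := (lebesgue_rV R N).

Lemma measurable_moving_ball d (X : measurableType d)
    (c g : X -> T) (r : X -> R) :
  measurable_fun setT c -> measurable_fun setT g -> measurable_fun setT r ->
  measurable [set z | ball (c z) (r z) (g z)].
Proof.
move=> mc mg mr.
have mlt (p q : X -> R) : measurable_fun setT p -> measurable_fun setT q ->
    measurable [set z | p z < q z].
  move=> mp mq; rewrite -[X in measurable X]setTI.
  have mpq := measurable_fun_ltr mp mq.
  exact: (mpq measurableT [set true] I).
rewrite (_ : mkset _ = \bigcap_(i in [set: 'I_N])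
    [set z | `|c z ord0 i - g z ord0 i| < r z]).
  apply: fin_bigcap_measurable; first exact: finite_finset.
  move=> i _; apply: mlt => //.
  apply: measurableT_comp => //; apply: measurable_funB;
    exact: (measurableT_comp (@measurable_coord_rV R N i)).
apply/seteqP; split=> z.
  by move=> [_ cg] i _; exact: (cg ord0 i).
move=> cg; apply/rV_ballE => [|i]; last exact: cg.
by apply: le_lt_trans (cg (Ordinal N0) I).
Qed.

Lemma integral_ball_indic (x : T) (r k : R) : 0 <= r -> 0 <= k ->
  (\int[mu]_y (k * \1_(ball x r) y)%:E)%E = (k * (2 * r) ^+ N)%:E.
Proof.
move=> r0 k0; have mB : measurable (ball x r).
  by apply: measurable_moving_ball => //; exact: measurable_cst.
under eq_integral do rewrite EFinM.
rewrite ge0_integralZl_EFin//; last first.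
  by apply/measurable_EFinP; exact: measurable_indic.
rewrite integral_indic// setIT EFinM; congr (_ * _)%E.
move: r0; rewrite le_eqVlt => /predU1P[<-|r0].
  rewrite mulr0 expr0n gtn_eqF//= (_ : ball _ _ = set0) ?measure0//.
  by apply/seteqP; split=> y //= -[]; rewrite ltxx.
exact: lebesgue_rV_ball.
Qed.

(** Tonelli with the inner integral over the second variable: its value is the
    volume of the ball. When the radius is 0 the ball is empty, consistently
    with 0 ^+ N = 0 for N > 0. *)
Lemma integral_moving_ball (c : T -> T) (r k : T -> R) :
  measurable_fun setT c -> measurable_fun setT r -> measurable_fun setT k ->
  (forall x, 0 <= r x) -> (forall x, 0 <= k x) ->
  (\int[mu \x mu]_z (k z.1 * \1_[set z | ball (c z.1) (r z.1) z.2] z)%:E)%E =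
  (\int[mu]_x (k x * (2 * r x) ^+ N)%:E)%E.
Proof.
move=> mc mr mk r0 k0; rewrite fubini_tonelli1; last 2 first.
- apply/measurable_EFinP; apply: measurable_funM; first exact: measurableT_comp.
  apply: measurable_indic; apply: measurable_moving_ball => //;
    exact: measurableT_comp.
- by move=> z; rewrite lee_fin mulr_ge0.
by apply: eq_integral => x _; rewrite -(integral_ball_indic (c x)).
Qed.

(** The same identity when the first variable moves in a ball that depends on
    the second one. *)
Lemma integral_moving_ball2 (c : T -> T) (r k : T -> R) :
  measurable_fun setT c -> measurable_fun setT r -> measurable_fun setT k ->
  (forall x, 0 <= r x) -> (forall x, 0 <= k x) ->
  (\int[mu \x mu]_z (k z.2 * \1_[set z | ball (c z.2) (r z.2) z.1] z)%:E)%E =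
  (\int[mu]_x (k x * (2 * r x) ^+ N)%:E)%E.
Proof.
move=> mc mr mk r0 k0; rewrite fubini_tonelli2; last 2 first.
- apply/measurable_EFinP; apply: measurable_funM; first exact: measurableT_comp.
  apply: measurable_indic; apply: measurable_moving_ball => //;
    exact: measurableT_comp.
- by move=> z; rewrite lee_fin mulr_ge0.
by apply: eq_integral => x _; rewrite -(integral_ball_indic (c x)).
Qed.

End moving_ball.

(** * The Hardy and Sobolev densities *)

Section densities.
Context {R : realType} {N : nat}.
Local Notation T := 'rV[R]_N.
Local Notation mu := (lebesgue_rV R N).
Local Notation punctured := (~` [set (0 : T)]).

Definition hardy_density (s : R) (A : R -> R) (f : T -> R) (x : T) : R :=
  A (`|f x| / enorm x `^ s).

Definition sobolev_density (s : R) (A : R -> R) (f : T -> R) (z : T * T) : R :=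
  A (`|f z.1 - f z.2| / enorm (z.1 - z.2) `^ s) / enorm (z.1 - z.2) ^+ N.

Context {s : R} {A : R -> R} {f : T -> R}.
Hypothesis s0 : 0 < s.
Hypothesis NA : N_function A.
Hypothesis cf : continuous f.

Lemma hardy_density_ge0 x : 0 <= hardy_density s A f x.
Proof. by rewrite N_function_ge0// divr_ge0// powR_ge0. Qed.

Lemma sobolev_density_ge0 z : 0 <= sobolev_density s A f z.
Proof.
rewrite divr_ge0 ?exprn_ge0 ?enorm_ge0// N_function_ge0//.
by rewrite divr_ge0// powR_ge0.
Qed.

Lemma enorm0 : enorm (0 : T) = 0.
Proof.
by apply/eqP; rewrite sqrtr_eq0 big1// => i _; rewrite mxE expr0n.
Qed.

(** At the origin the quotient is by 0 `^ s = 0, hence 0, and A(0) = 0. So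
    integrating the density over the whole space gives the modular of the
    punctured one. *)
Lemma hardy_density_origin : hardy_density s A f 0 = 0.
Proof.
by rewrite /hardy_density enorm0 powR0 ?gt_eqF// invr0 mulr0 N_function_at0.
Qed.

Lemma hardy_modular_punctured :
  hardy_modular s A punctured f = (\int[mu]_x (hardy_density s A f x)%:E)%E.
Proof.
rewrite /hardy_modular integral_mkcond; apply: eq_integral => x _.
rewrite /patch; case: ifPn => [_|]; first by rewrite dist_compl_origin.
by rewrite notin_setE/= => /contrapT ->; rewrite hardy_density_origin.
Qed.

Lemma measurable_punctured : measurable punctured.
Proof.
apply: open_measurable_rV; apply: closed_openC; apply: accessible_closed_set1.
by apply: hausdorff_accessible; exact: norm_hausdorff.
Qed.

Lemma measurable_hardy_density : measurable_fun setT (hardy_density s A f).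
Proof.
apply: (N_function_measurable NA) => [x|]; first by rewrite divr_ge0 ?powR_ge0.
apply: measurable_funM.
  by apply: measurableT_comp => //; exact: continuous_measurable_rV.
under eq_fun do rewrite -powRN.
by apply: (measurableT_comp (measurable_powR _)); exact: measurable_enorm.
Qed.

Lemma measurable_sobolev_density : measurable_fun setT (sobolev_density s A f).
Proof.
have mf := continuous_measurable_rV cf.
have md : measurable_fun setT (fun z : T * T => enorm (z.1 - z.2)).
  by apply: measurable_enorm; exact: measurable_subrV.
apply: measurable_funM; last first.
  under eq_fun do rewrite -powR_mulrn ?enorm_ge0// -powRN.
  exact: (measurableT_comp (measurable_powR _)).
apply: (N_function_measurable NA) => [z|]; first by rewrite divr_ge0 ?powR_ge0.
apply: measurable_funM.
  apply: measurableT_comp => //; apply: measurable_funB;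
    exact: (measurableT_comp mf).
under eq_fun do rewrite -powRN.
exact: (measurableT_comp (measurable_powR _)).
Qed.

End densities.

(** * Hardy modulars of test functions are finite and positive *)

Section test_functions.
Context {R : realType} {N : nat}.
Local Notation T := 'rV[R]_N.
Local Notation mu := (lebesgue_rV R N).
Local Notation punctured := (~` [set (0 : T)]).

Lemma test_function_continuous (D : set T) (f : T -> R) :
  test_function D f -> continuous f.
Proof. by case=> sf _ _; exact: (sf [::]).1. Qed.

Lemma test_function_neq0 (D : set T) (f : T -> R) x :
  test_function D f -> f x != 0 -> D x.
Proof. by case=> _ _ fD fx; apply: fD; exact: subset_closure. Qed.

Lemma compact_rV_ball (K : set T) : compact K ->
  exists2 r, 0 < r & K `<=` ball 0 r.
Proof.
move=> /compact_bounded[M [_ MK]]; pose r := Num.max 0 M + 1.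
have r0 : 0 < r by rewrite ltr_pwDr// le_max lexx.
exists (r + 1) => [|x Kx]; first exact: addr_gt0.
rewrite mx_norm_ball /ball_/= sub0r normrN.
apply: (@le_lt_trans _ _ r); last by rewrite ltrDl.
by apply: MK => //; rewrite /r ltr_pwDr// le_max lexx orbT.
Qed.

Lemma test_function_bounded (D : set T) (f : T -> R) :
  test_function D f -> exists2 M, 0 < M & forall x, `|f x| <= M.
Proof.
move=> tf; have cf := test_function_continuous tf; case: (tf) => _ cK _.
have /compact_bounded[M [_ MK]] :
    compact (f @` closure [set x | f x != 0]).
  apply: continuous_compact => //.
  by apply: continuous_subspaceT => x; exact: cf.
pose r := Num.max 0 M + 1.
have r0 : 0 < r by rewrite ltr_pwDr// le_max lexx.
exists r => // x; have [->|fx0] := eqVneq (f x) 0; first by rewrite normr0 ltW.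
apply: MK; first by rewrite /r ltr_pwDr// le_max lexx orbT.
by exists x => //; exact: subset_closure.
Qed.

(** The origin is outside the closed support, which therefore misses a ball
    around it. *)
Lemma test_function_punctured (f : T -> R) :
  test_function punctured f ->
  exists2 r, 0 < r & forall x, f x != 0 -> r <= enorm x.
Proof.
case=> _ _ K0.
have : nbhs (0 : T) (~` closure [set x | f x != 0]).
  apply: open_nbhs_nbhs; split; first exact/closed_openC/closed_closure.
  by move=> /K0 /(_ erefl).
move=> /nbhs_ballP[r /= r0 rK]; exists r => // x fx.
rewrite leNgt; apply/negP => xr; apply: (rK x); last exact: subset_closure.
apply/(rV_ballE _ _ r0) => i.
by rewrite mxE sub0r normrN (le_lt_trans (coord_le_enorm _ _)).
Qed.

Context {s : R} {A : R -> R} {f : T -> R}.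
Hypothesis N0 : (0 < N)%N.
Hypothesis s0 : 0 < s.
Hypothesis NA : N_function A.
Hypothesis tf : test_function punctured f.

(** The density is at most A(M / d^s), where M bounds |f| and the support of f
    keeps a distance at least d from the origin, and it vanishes off a ball. *)
Lemma hardy_modular_fin : (hardy_modular s A punctured f < +oo)%E.
Proof.
have cf := test_function_continuous tf.
have [M M0 fM] := test_function_bounded tf.
have [d d0 fd] := test_function_punctured tf.
have [r r0 fr] : exists2 r, 0 < r & closure [set x | f x != 0] `<=` ball 0 r.
  by apply: compact_rV_ball; case: tf.
rewrite hardy_modular_punctured//.
pose c := A (M / d `^ s).
have c0 : 0 <= c by rewrite N_function_ge0// divr_ge0 ?powR_ge0 ?ltW.
apply: (@le_lt_trans _ _ (\int[mu]_x (c * \1_(ball (0 : T) r) x)%:E)%E).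
  apply: ge0_le_integral => //.
  - by move=> x _; rewrite lee_fin hardy_density_ge0.
  - by apply/measurable_EFinP; exact: measurable_hardy_density.
  - apply/measurable_EFinP; apply: measurable_funM => //.
    by apply: measurable_indic; exact: measurable_rV_ball.
  - move=> x _; rewrite lee_fin /hardy_density.
    have [->|fx0] := eqVneq (f x) 0.
      by rewrite normr0 mul0r N_function_at0// mulr_ge0.
    rewrite indicE mem_set ?mulr1; last by apply: fr; exact: subset_closure.
    apply: (N_function_nd NA); rewrite divr_ge0 ?powR_ge0//=.
    apply: ler_pM => //; rewrite ?invr_ge0 ?powR_ge0//.
    rewrite lef_pV2 ?posrE ?powR_gt0 ?(lt_le_trans d0 (fd _ fx0))//.
    by rewrite ge0_ler_powR ?nnegrE ?(ltW d0) ?(ltW s0) ?enorm_ge0// fd.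
by rewrite (integral_ball_indic N0 _ (ltW r0) c0) ltry.
Qed.

Hypothesis D2A : Delta2 A.

(** Around a point where f does not vanish, |f| and hence the density are
    bounded below by positive constants on a ball. *)
Lemma hardy_modular_gt0 : f <> cst 0 -> (0 < hardy_modular s A punctured f)%E.
Proof.
move=> f0; have cf := test_function_continuous tf.
have [x0 fx0] : exists x0, f x0 != 0.
  apply: contra_notP f0 => /forallNP f0; apply/funext => x /=.
  by apply/eqP; apply/negPn/negP; exact: f0.
have c0 : 0 < `|f x0| / 2 by rewrite divr_gt0 ?normr_gt0.
have : nbhs x0 [set x | `|f x0| / 2 < `|f x|].
  apply: (cf x0 [set t | `|f x0| / 2 < `|t|]); apply: open_nbhs_nbhs.
  split; last by rewrite /= ltr_pdivrMr// mulr_natr mulr2n ltrDl normr_gt0.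
  apply: (@open_comp _ _ (@Num.norm _ R) [set u | `|f x0| / 2 < u]).
    by move=> u _; exact: norm_continuous.
  exact: open_gt.
move=> /nbhs_ballP[r /= r0 rf].
pose M := N%:R * (enorm x0 + r).
have xM x : ball x0 r x -> 0 < enorm x <= M.
  move=> x0x; apply/andP; split.
    apply: enorm_gt0; apply/eqP; apply: (test_function_neq0 tf).
    by rewrite -normr_gt0 (lt_trans c0)//; exact: rf.
  apply: enorm_le => [|i]; first by rewrite addr_ge0 ?enorm_ge0 ?ltW.
  rewrite -[x ord0 i](subrK (x0 ord0 i)) addrC (le_trans (ler_normD _ _))//.
  rewrite lerD ?coord_le_enorm// distrC ltW//.
  by have /(rV_ballE _ _ r0) := x0x; exact.
rewrite hardy_modular_punctured//.
pose c := A ((`|f x0| / 2) / M `^ s).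
have M0 : 0 < M by have /andP[] := xM x0 (ballxx x0 r0); exact: lt_le_trans.
have c'0 : 0 < c by apply: Delta2_gt0 => //; rewrite divr_gt0// powR_gt0.
apply: (@lt_le_trans _ _ (\int[mu]_x (c * \1_(ball x0 r) x)%:E)%E).
  rewrite (integral_ball_indic N0 _ (ltW r0) (ltW c'0)) lte_fin.
  by rewrite mulr_gt0// exprn_gt0// mulr_gt0.
apply: ge0_le_integral => //.
- by move=> x _; rewrite lee_fin mulr_ge0// ltW.
- apply/measurable_EFinP; apply: measurable_funM => //.
  by apply: measurable_indic; exact: measurable_rV_ball.
- by apply/measurable_EFinP; exact: measurable_hardy_density.
- move=> x _; rewrite lee_fin /hardy_density.
  have [x0x|x0x] := pselect (ball x0 r x); last first.
    by rewrite indicE memNset// mulr0; exact: (hardy_density_ge0 NA).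
  rewrite indicE mem_set// mulr1; have /andP[ex xM'] := xM _ x0x.
  apply: (N_function_nd NA); rewrite divr_ge0 ?powR_ge0 ?(ltW c0)//=.
  apply: ler_pM; rewrite ?invr_ge0 ?powR_ge0 ?(ltW c0)//.
    by apply: ltW; exact: rf.
  rewrite lef_pV2 ?posrE ?powR_gt0//.
  by rewrite ge0_ler_powR ?nnegrE ?(ltW M0) ?(ltW s0) ?(ltW ex).
Qed.

End test_functions.

(** * The pointwise transport estimate *)

Section pointwise_estimate.
Context {R : realType} {N : nat} {s : R} {A : R -> R} {f : 'rV[R]_N -> R}.
Local Notation T := 'rV[R]_N.
Hypothesis N0 : (0 < N)%N.
Hypothesis s0 : 0 < s.
Hypothesis NA : N_function A.
Local Notation g := (hardy_density s A f).

Lemma ler_div_powR (k d e u : R) :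
  0 <= k -> 0 < d -> 0 < e -> d <= k * e -> 0 <= u ->
  u / e `^ s <= k `^ s * (u / d `^ s).
Proof.
move=> k0 d0 e0 dke u0; rewrite ler_pdivrMr ?powR_gt0//.
rewrite mulrCA -mulrA ler_peMr//.
rewrite mulrC mulrA -powRM ?(ltW e0)// ler_pdivlMr ?powR_gt0// mul1r.
rewrite [e * k]mulrC ge0_ler_powR ?nnegrE ?(ltW d0) ?(ltW s0)//.
by rewrite mulr_ge0 ?(ltW e0).
Qed.

Lemma ler_invXn (k d e : R) : 0 <= k -> 0 < d -> 0 < e -> d <= k * e ->
  (e ^+ N)^-1 <= k ^+ N / d ^+ N.
Proof.
move=> k0 d0 e0 dke; rewrite -div1r ler_pdivrMr ?exprn_gt0//.
rewrite mulrAC ler_pdivlMr ?exprn_gt0// mul1r -exprMn.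
by rewrite lerXn2r ?nnegrE ?(ltW d0) ?mulr_ge0 ?(ltW e0).
Qed.

Context {K K1 K2 lam al : R}.
Let rho := lam `^ s^-1.
Let kappa := N%:R * (1 + 2 * rho).
Hypothesis lam0 : 0 < lam.
Hypotheses (K0 : 0 < K) (K10 : 0 < K1) (K20 : 0 < K2).
Hypothesis AD : forall u v, 0 <= u -> 0 <= v -> A (u + v) <= K * (A u + A v).
Hypothesis AK1 : forall t, 0 <= t -> A (kappa `^ s * t) <= K1 * A t.
Hypothesis AK2 : forall t, 0 <= t -> A ((2 * N%:R) `^ s * t) <= K2 * A t.
Hypothesis Alam : forall t, 0 <= t -> A (lam * t) <= al * rho * A t.

(** Every y in the ball has all its coordinates in ]rho |x|, 2 rho |x|[, so
    rho |x| < |y| <= 2 N rho |x| and |x - y| <= kappa |x|. These comparisons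
    replace |x| by |x - y| in the term with f x - f y and by |y| in the term
    with f y. The third conclusion confines x when y is given. *)
Lemma transport_pointwise x y :
  ball (const_mx (3 / 2 * rho * enorm x) : T) (rho * enorm x / 2) y ->
  [/\ x != 0, y != 0, ball (0 : T) (2 * enorm y / rho) x &
   g x / (rho * enorm x) ^+ N <=
     K * K1 * (kappa / rho) ^+ N * sobolev_density s A f (x, y) +
     K * K2 * (2 * N%:R) ^+ N * (al * rho) * (g y / enorm y ^+ N)].
Proof.
set e := enorm x => xy.
have rho0 : 0 < rho by rewrite powR_gt0.
have N0' : 0 < N%:R :> R by rewrite ltr0n.
have re0 : 0 < rho * e / 2 by case: xy => /(le_lt_trans _)->.
have e0 : 0 < e by rewrite -(pmulr_rgt0 _ rho0); lra.
have {}xy i : rho * e < y ord0 i < 2 * (rho * e).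
  have /(rV_ballE _ _ re0)/(_ i) := xy.
  by rewrite mxE ltr_norml; move=> /andP[? ?]; apply/andP; split; lra.
have re_y : rho * e < enorm y.
  apply: lt_le_trans (coord_le_enorm y (Ordinal N0)).
  by apply: lt_le_trans (ler_norm _); have /andP[] := xy (Ordinal N0).
have ey0 : 0 < enorm y by apply: lt_trans re_y; rewrite mulr_gt0.
have y_re : enorm y <= (2 * N%:R * rho) * e.
  rewrite [leRHS](_ : _ = N%:R * (2 * (rho * e))); last by ring.
  apply: enorm_le => [|i]; first by rewrite mulr_ge0// ltW// mulr_gt0.
  have /andP[y1 y2] := xy i.
  by rewrite ger0_norm ?(ltW y2)// ltW// (lt_trans _ y1)// mulr_gt0.
have d_e : enorm (x - y) <= kappa * e.
  rewrite /kappa -mulrA; apply: enorm_le => [|i].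
    by rewrite mulr_ge0 ?(ltW e0)// addr_ge0// mulr_ge0 ?(ltW rho0).
  have /andP[y1 y2] := xy i; rewrite !mxE (le_trans (ler_normB _ _))//.
  rewrite mulrDl mul1r lerD ?coord_le_enorm//.
  by rewrite ger0_norm -?mulrA ?(ltW y2)// ltW// (lt_trans _ y1)// mulr_gt0.
have kappa0 : 0 < kappa.
  by rewrite mulr_gt0// addr_gt0// mulr_gt0.
split.
- by apply/eqP => x0; move: e0; rewrite /e x0 enorm0 ltxx.
- by apply/eqP => y0; move: ey0; rewrite y0 enorm0 ltxx.
- apply/rV_ballE => [|i]; first by rewrite divr_gt0// mulr_gt0.
  rewrite mxE sub0r normrN (le_lt_trans (coord_le_enorm _ _))//.
  rewrite ltr_pdivlMr// mulrC (lt_trans re_y)//.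
  by rewrite ltr_pMl// ltr1n.
have u0 (z : R) : 0 <= `|z| / e `^ s by rewrite divr_ge0 ?powR_ge0.
have gx : g x <= K * (A (`|f x - f y| / e `^ s) + A (`|f y| / e `^ s)).
  apply: (@le_trans _ _ (A (`|f x - f y| / e `^ s + `|f y| / e `^ s)));
    last exact: AD.
  apply: (N_function_nd NA).
  rewrite u0/= -mulrDl ler_wpM2r ?invr_ge0 ?powR_ge0//.
  by rewrite -{1}(subrK (f y) (f x)) ler_normD.
have ren0 : 0 <= ((rho * e) ^+ N)^-1.
  by rewrite invr_ge0 exprn_ge0// ltW// mulr_gt0.
have near_part : A (`|f x - f y| / e `^ s) / (rho * e) ^+ N <=
    K1 * (kappa / rho) ^+ N * sobolev_density s A f (x, y).
  (* On the diagonal |x - y| is not comparable to |x|, but A(0) = 0. *)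
  have [->|xNy] := eqVneq x y.
    rewrite subrr normr0 mul0r N_function_at0// mul0r mulr_ge0//.
      by rewrite mulr_ge0 ?(ltW K10)// exprn_ge0// divr_ge0 ?ltW.
    exact: sobolev_density_ge0.
  have d0 : 0 < enorm (x - y) by apply: enorm_gt0; rewrite subr_eq0.
  rewrite /sobolev_density/=.
  rewrite (_ : _ * _ * _ =
    K1 * A (`|f x - f y| / enorm (x - y) `^ s) *
    (kappa ^+ N / enorm (x - y) ^+ N / rho ^+ N)); last first.
    by rewrite expr_div_n; ring.
  apply: ler_pM.
  - exact: (N_function_ge0 NA).
  - exact: ren0.
  - apply: (@le_trans _ _
      (A (kappa `^ s * (`|f x - f y| / enorm (x - y) `^ s))));
      last by apply: AK1; rewrite divr_ge0 ?powR_ge0.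
    apply: (N_function_nd NA); rewrite u0/=.
    by apply: ler_div_powR => //; exact: ltW.
  - rewrite exprMn invfM mulrC ler_pM2r ?invr_gt0 ?exprn_gt0//.
    by apply: ler_invXn => //; exact: ltW.
have far_part : A (`|f y| / e `^ s) / (rho * e) ^+ N <=
    K2 * (2 * N%:R) ^+ N * (al * rho) * (g y / enorm y ^+ N).
  rewrite [leRHS](_ : _ = K2 * (al * rho * g y) *
    ((2 * N%:R) ^+ N / enorm y ^+ N)); last by ring.
  apply: ler_pM.
  - exact: (N_function_ge0 NA).
  - exact: ren0.
  - have v0 : 0 <= `|f y| / enorm y `^ s by rewrite divr_ge0 ?powR_ge0.
    apply: (@le_trans _ _ (K2 * A (lam * (`|f y| / enorm y `^ s)))); last first.
      by rewrite ler_pM2l// Alam.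
    apply: (@le_trans _ _
      (A ((2 * N%:R) `^ s * (lam * (`|f y| / enorm y `^ s)))));
      last by apply: AK2; rewrite mulr_ge0// ltW.
    apply: (N_function_nd NA); rewrite u0/=.
    rewrite mulrA -[X in _ `^ _ * X](_ : rho `^ s = lam); last first.
      by rewrite -powRrM mulVf ?gt_eqF// powRr1// ltW.
    rewrite -powRM ?mulr_ge0 ?(ltW rho0)//.
    by apply: ler_div_powR => //; rewrite ltW// !mulr_gt0.
  - rewrite [leLHS](_ : _ = (e ^+ N)^-1 / rho ^+ N); last first.
      by rewrite exprMn invfM mulrC.
    rewrite ler_pdivrMr ?exprn_gt0//.
    rewrite mulrAC -exprMn; apply: ler_invXn => //.
    by rewrite ltW// !mulr_gt0.
rewrite (le_trans (ler_wpM2r ren0 gx))//.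
rewrite -[leLHS]mulrA (mulrDl _ _ ((rho * e) ^+ N)^-1).
rewrite (le_trans (ler_wpM2l (ltW K0) (lerD near_part far_part)))//.
by rewrite mulrDr !mulrA.
Qed.

End pointwise_estimate.

(** * Choosing lambda and integrating the estimate *)

(** An inferior limit below c leaves values below c in every set of the
    filter. *)
Lemma limf_einf_lt {T : choiceType} {X : filteredType T} {R : realType}
    (f : X -> \bar R) (F : set (set X)) (P : set X) (c : \bar R) :
  F P -> (limf_einf f F < c)%E -> exists2 x, P x & (f x < c)%E.
Proof.
move=> FP fc; have : (ereal_inf (f @` P) < c)%E.
  apply: le_lt_trans fc; rewrite limf_einfE.
  by apply: ereal_sup_ubound; exists P.
by move=> /ereal_inf_lt[_ [x Px <-] fxc]; exists x.
Qed.

Section alpha_theory.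
Context {R : realType} {A : R -> R} {s : R}.
Hypothesis NA : N_function A.
Hypothesis D2A : Delta2 A.

(** A finite product with a positive weight forces alpha(lambda) to be a real
    number, which then dominates each of the quotients defining it. *)
Lemma alpha_bound (lam w eps : R) : 0 < lam -> 0 < w ->
  (w%:E * alpha s A lam < eps%:E)%E ->
  exists al, [/\ 0 <= al, w * al < eps &
    forall t, 0 <= t -> A (lam * t) <= al * lam `^ s^-1 * A t].
Proof.
move=> lam0 w0; have : (0 <= alpha s A lam)%E.
  apply: (@le_trans _ _ (A (lam * 1) / (lam `^ s^-1 * A 1))%:E).
    rewrite lee_fin divr_ge0 ?mulr_ge0 ?powR_ge0 ?(N_function_ge0 NA)//.
    by rewrite mulr1 ltW.
  by apply: ereal_sup_ubound; exists 1 => //=.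
case E : (alpha s A lam) => [al| |]//; last first.
  by rewrite gt0_muley ?lte_fin.
rewrite lee_fin -EFinM lte_fin => al0 wal; exists al; split=> // t.
rewrite le_eqVlt => /predU1P[<-|t0].
  by rewrite mulr0 N_function_at0// mulr0.
have : ((A (lam * t) / (lam `^ s^-1 * A t))%:E <= alpha s A lam)%E.
  by apply: ereal_sup_ubound; exists t.
rewrite E lee_fin ler_pdivrMr ?mulrA// mulr_gt0 ?powR_gt0//.
exact: Delta2_gt0.
Qed.

End alpha_theory.

Section absorption.
Context {R : realType} {N : nat} {s : R} {A : R -> R} {f : 'rV[R]_N -> R}.
Local Notation T := 'rV[R]_N.
Local Notation mu := (lebesgue_rV R N).
Local Notation punctured := (~` [set (0 : T)]).
Local Notation g := (hardy_density s A f).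
Local Notation Phi := (sobolev_density s A f).
Hypothesis N0 : (0 < N)%N.
Hypothesis s0 : 0 < s.
Hypothesis NA : N_function A.
Hypothesis cf : continuous f.

Context {rho C1 C2 : R}.
Hypothesis rho0 : 0 < rho.
Hypotheses (C10 : 0 <= C1) (C20 : 0 <= C2).
Hypothesis transport : forall x y,
  ball (const_mx (3 / 2 * rho * enorm x) : T) (rho * enorm x / 2) y ->
  [/\ x != 0, y != 0, ball (0 : T) (2 * enorm y / rho) x &
   g x / (rho * enorm x) ^+ N <=
     C1 * Phi (x, y) + C2 * (g y / enorm y ^+ N)].

Let Phi0 : T * T -> R := Phi \_ (punctured `*` punctured).
Let h1 (z : T * T) := g z.1 / (rho * enorm z.1) ^+ N * \1_[set z : T * T |
  ball (const_mx (3 / 2 * rho * enorm z.1) : T) (rho * enorm z.1 / 2) z.2] z.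
Let h2 (z : T * T) := g z.2 / enorm z.2 ^+ N *
  \1_[set z : T * T | ball (0 : T) (2 * enorm z.2 / rho) z.1] z.

Let menorm : measurable_fun setT (fun x : T => enorm x).
Proof. exact: measurable_enorm. Qed.

Let mg := measurable_hardy_density (s := s) NA cf.
Let g0 := hardy_density_ge0 (N := N) (s := s) (f := f) NA.

Let mk1 : measurable_fun setT (fun x : T => g x / (rho * enorm x) ^+ N).
Proof.
apply: measurable_funM => //.
under eq_fun do
  rewrite -powR_mulrn ?mulr_ge0 ?enorm_ge0 ?(ltW rho0)// -powRN.
apply: (measurableT_comp (measurable_powR _)).
exact: measurable_funM.
Qed.

Let mk2 : measurable_fun setT (fun x : T => g x / enorm x ^+ N).
Proof.
apply: measurable_funM => //.
under eq_fun do rewrite -powR_mulrn ?enorm_ge0// -powRN.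
exact: (measurableT_comp (measurable_powR _)).
Qed.

Let mc1 : measurable_fun setT
  (fun x : T => const_mx (3 / 2 * rho * enorm x) : T).
Proof.
apply: measurable_fun_rVP => i; under eq_fun do rewrite mxE.
exact: measurable_funM.
Qed.

Let mr1 : measurable_fun setT (fun x : T => rho * enorm x / 2).
Proof. by apply: measurable_funM => //; exact: measurable_funM. Qed.

Let mr2 : measurable_fun setT (fun x : T => 2 * enorm x / rho).
Proof. by apply: measurable_funM => //; exact: measurable_funM. Qed.

Let k1_ge0 x : 0 <= g x / (rho * enorm x) ^+ N.
Proof. by rewrite divr_ge0 ?exprn_ge0 ?mulr_ge0 ?enorm_ge0 ?(ltW rho0). Qed.

Let k2_ge0 x : 0 <= g x / enorm x ^+ N.
Proof. by rewrite divr_ge0 ?exprn_ge0 ?enorm_ge0. Qed.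

Let int_h1 : (\int[mu \x mu]_z (h1 z)%:E)%E = hardy_modular s A punctured f.
Proof.
rewrite (integral_moving_ball N0 mc1 mr1 mk1) => [|x|//]; last first.
  by rewrite divr_ge0 ?mulr_ge0 ?enorm_ge0 ?(ltW rho0).
rewrite hardy_modular_punctured//; apply: eq_integral => x _; congr EFin.
have [->|x0] := eqVneq x 0; first by rewrite hardy_density_origin// !mul0r.
rewrite (mulrC 2) divfK// divfK// expf_neq0// mulf_neq0 ?gt_eqF//.
exact: enorm_gt0.
Qed.

Let int_h2 : (\int[mu \x mu]_z (h2 z)%:E)%E =
  (((4 / rho) ^+ N)%:E * hardy_modular s A punctured f)%E.
Proof.
rewrite (integral_moving_ball2 N0 (@measurable_cst _ _ _ _ _ (0 : T)) mr2 mk2)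
  => [|x|//]; last first.
  by rewrite divr_ge0 ?mulr_ge0 ?enorm_ge0 ?(ltW rho0).
rewrite hardy_modular_punctured// -ge0_integralZl_EFin//; last 3 first.
- by move=> x _; rewrite lee_fin.
- exact/measurable_EFinP.
- by rewrite exprn_ge0// divr_ge0// ltW.
apply: eq_integral => x _; rewrite -EFinM; congr EFin.
have [->|x0] := eqVneq x 0.
  by rewrite hardy_density_origin// mulr0 !mul0r.
have ex : enorm x ^+ N != 0 by rewrite expf_neq0// gt_eqF// enorm_gt0.
rewrite (_ : 2 * _ = 4 / rho * enorm x); last by field; rewrite gt_eqF.
by rewrite [in LHS]exprMn -[LHS]mulrA [_^-1 * _]mulrCA mulVf// mulr1 mulrC.
Qed.

Let mD : measurable (punctured `*` punctured).
Proof. by apply: measurableX; exact: measurable_punctured. Qed.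

Let int_Phi0 : (\int[mu \x mu]_z (Phi0 z)%:E)%E =
  sobolev_modular s A punctured f.
Proof.
rewrite /sobolev_modular [RHS]integral_mkcond; apply: eq_integral => z _.
by rewrite /Phi0 /patch; case: ifP.
Qed.

Let mPhi0 : measurable_fun setT Phi0.
Proof.
apply/(measurable_restrictT _ mD).
apply: measurable_funTS; exact: measurable_sobolev_density.
Qed.

Let Phi0_ge0 z : 0 <= Phi0 z.
Proof.
by rewrite /Phi0 /patch; case: ifP => // _; exact: sobolev_density_ge0.
Qed.

Let mh1 : measurable_fun setT h1.
Proof.
apply: measurable_funM; first exact: (measurableT_comp mk1).
apply: measurable_indic; apply: measurable_moving_ball => //.
  exact: (measurableT_comp mc1).
exact: (measurableT_comp mr1).
Qed.

Let mh2 : measurable_fun setT h2.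
Proof.
apply: measurable_funM; first exact: (measurableT_comp mk2).
apply: measurable_indic; apply: measurable_moving_ball => //.
exact: (measurableT_comp mr2).
Qed.

Let h1_le z : h1 z <= C1 * Phi0 z + C2 * h2 z.
Proof.
case: z => x y; rewrite /h1 /h2 !indicE/=.
have [xy|xy] := pselect (ball (const_mx (3 / 2 * rho * enorm x) : T)
    (rho * enorm x / 2) y); last first.
  rewrite memNset// mulr0 addr_ge0// mulr_ge0//.
  by rewrite mulr_ge0.
have [x0 y0 yx] := transport xy.
rewrite /Phi0 patchE !mem_set ?mulr1//.
by split; apply/eqP.
Qed.

(** Integral over the pairs (x, y) with y in the ball attached to x. The volume
    (rho |x|)^N of that ball cancels the denominator on the left; the points x
    that see a given y fill at most a ball of volume (4 |y| / rho)^N, whence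
    the factor (4 / rho)^N on the right. *)
Lemma hardy_modular_transport :
  (hardy_modular s A punctured f <=
   C1%:E * sobolev_modular s A punctured f +
   (C2 * (4 / rho) ^+ N)%:E * hardy_modular s A punctured f)%E.
Proof.
rewrite -[leLHS]int_h1 EFinM -muleA -int_h2 -int_Phi0.
have h2_ge0 z : 0 <= h2 z by rewrite mulr_ge0.
have h1_ge0 z : 0 <= h1 z by rewrite mulr_ge0.
rewrite -ge0_integralZl_EFin//; last 2 first.
- by move=> z _; rewrite lee_fin.
- exact/measurable_EFinP.
rewrite -ge0_integralZl_EFin//; last 2 first.
- by move=> z _; rewrite lee_fin.
- exact/measurable_EFinP.
rewrite -ge0_integralD//; last 4 first.
- by move=> z _; rewrite mule_ge0 ?lee_fin.
- by apply: measurable_funeM; exact/measurable_EFinP.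
- by move=> z _; rewrite mule_ge0 ?lee_fin.
- by apply: measurable_funeM; exact/measurable_EFinP.
apply: ge0_le_integral => //.
- by move=> z _; rewrite lee_fin.
- exact/measurable_EFinP.
- by apply: emeasurable_funD; apply: measurable_funeM; exact/measurable_EFinP.
- by move=> z _; rewrite -!EFinM -EFinD lee_fin.
Qed.

End absorption.

(** * The Hardy inequality *)

Theorem theorem1p4 (R : realType) (N : nat) (s : R) (A : R -> R)
    (hN : (0 < N)%N) (hs0 : 0 < s) (hs1 : s < 1)
    (hA : N_function A) (hA2 : Delta2 A)
    (halpha :
      limf_einf (fun lambda : R =>
        ((lambda `^ ((1 - N%:R) / s))%:E * alpha s A lambda)%E) 0^'+ = 0%E
      \/
      limf_einf (fun lambda : R =>
        ((lambda `^ ((1 - N%:R) / s))%:E * alpha s A lambda)%E) +oo = 0%E) :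
  FOHI s A (~` [set (0 : 'rV[R]_N)]).
Proof.
(* K and K2 do not depend on lambda, so lambda may be chosen after them. *)
have [K K0 AD] := Delta2_add hA hA2.
have n0 : 0 < N%:R :> R by rewrite ltr0n.
have [K2 K20 AK2] : exists2 K2, 0 < K2 &
    forall t, 0 <= t -> A ((2 * N%:R) `^ s * t) <= K2 * A t.
  by apply: Delta2_scale => //; rewrite powR_gt0// mulr_gt0.
pose B := K * K2 * (2 * N%:R) ^+ N * 4 ^+ N.
have B0 : 0 < B by rewrite !mulr_gt0// exprn_gt0// mulr_gt0.
have eps0 : (0 < (2 * B)^-1%:E)%E by rewrite lte_fin invr_gt0 mulr_gt0.
have [lam lam0 lam_small] : exists2 lam, 0 < lam &
    ((lam `^ ((1 - N%:R) / s))%:E * alpha s A lam < (2 * B)^-1%:E)%E.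
  case: halpha => h; rewrite -h in eps0.
    by apply: limf_einf_lt eps0; exact: nbhs_right_gt.
  by apply: limf_einf_lt eps0; exact: nbhs_pinfty_gt.
have w0 : 0 < lam `^ ((1 - N%:R) / s) by exact: powR_gt0.
have [al [al0 al_small Alam]] := alpha_bound hA hA2 lam0 w0 lam_small.
pose rho := lam `^ s^-1; have rho0 : 0 < rho by exact: powR_gt0.
have wE : lam `^ ((1 - N%:R) / s) = rho / rho ^+ N.
  rewrite mulrC powRrM -/rho powRB ?(gt_eqF rho0) ?implybT//.
  by rewrite powRr1 ?powR_mulrn// ltW.
pose kappa := N%:R * (1 + 2 * rho).
have kappa0 : 0 < kappa by rewrite mulr_gt0// addr_gt0// mulr_gt0.
have [K1 K10 AK1] : exists2 K1, 0 < K1 &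
    forall t, 0 <= t -> A (kappa `^ s * t) <= K1 * A t.
  by apply: Delta2_scale => //; rewrite powR_gt0.
pose C1 := K * K1 * (kappa / rho) ^+ N.
have C10 : 0 < C1 by rewrite !mulr_gt0// exprn_gt0// divr_gt0.
pose C2 := K * K2 * (2 * N%:R) ^+ N * (al * rho).
have C20 : 0 <= C2.
  by rewrite mulr_ge0 ?mulr_ge0 ?exprn_ge0 ?(ltW K0) ?(ltW K20) ?(ltW rho0).
have half : C2 * (4 / rho) ^+ N <= 2^-1.
  rewrite (_ : _ * _ = B * (rho / rho ^+ N * al)); last first.
    by rewrite expr_div_n /B /C2; ring.
  rewrite -wE -ler_pdivlMl// ltW// (lt_le_trans al_small)//.
  by rewrite invfM mulrC.
apply: (@lt_le_trans _ _ ((2 * C1)^-1%:E)).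
  by rewrite lte_fin invr_gt0 mulr_gt0.
apply: le_ereal_inf_tmp => _ [f [tf f0] <-].
have := @hardy_modular_transport _ _ _ _ f hN hs0 hA
  (test_function_continuous tf) rho C1 C2 rho0 (ltW C10) C20
  (transport_pointwise hN hs0 hA lam0 K0 K10 K20 AD AK1 AK2 Alam).
have := hardy_modular_gt0 hN hs0 hA tf hA2 f0.
have := hardy_modular_fin hN hs0 hA tf.
case: (hardy_modular _ _ _ _) => [a| |]//= _; rewrite lte_fin => a0.
(* H = a is a positive real: a <= C1 m + a / 2 is to be solved for a. *)
rewrite inver gt_eqF// lee_pdivlMr//.
case: (sobolev_modular _ _ _ _) => [m| |]; last 2 first.
- by rewrite leey.
- by rewrite gt0_muleNy ?lte_fin.
rewrite -!EFinM -EFinD !lee_fin => am.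
rewrite ler_pdivrMl; last by rewrite mulr_gt0.
have : C2 * (4 / rho) ^+ N * a <= 2^-1 * a by rewrite ler_wpM2r// ltW.
by nra.
Qed.
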